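(* Let $n=\sum_{i=1}^Nn_i$ with $n_i\in\mathbb{N}$, and let $Q=Q^T\succ0$ and $A=\mathrm{diag}(\alpha_1I_{n_1},\dots,\alpha_NI_{n_N})\succ0$ be two $n\times n$ real matrices with respective condition numbers $k_Q=\frac{\lambda_1(Q)}{\lambda_n(Q)}$ and $k_A=\frac{\lambda_1(A)}{\lambda_n(A)}=\frac{\alpha_{max}}{\alpha_{min}}$, where $\alpha_{max}=\max_i\alpha_i$ and $\alpha_{min}=\min_i\alpha_i$. If $\frac{\alpha_{max}}{\alpha_{min}}<k_Q$, then $k_{Q+A}<k_Q$.
   Context: For a symmetric positive definite $n\times n$ matrix $M$, $\lambda_1(M)\ge\dots\ge\lambda_n(M)$ denote its eigenvalues and $k_M:=\lambda_1(M)/\lambda_n(M)$ its spectral condition number. $I_m$ is the $m\times m$ identity matrix. *)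

(* Defs.v *)
From mathcomp Require Import all_boot all_order all_algebra.
From mathcomp Require Import polyrcf.

Set Implicit Arguments.
Unset Strict Implicit.
Unset Printing Implicit Defensive.

Import Order.TTheory GRing.Theory Num.Theory.
Local Open Scope ring_scope.

Definition sym_posdef (R : numDomainType) n (M : 'M[R]_n) : Prop :=
  M^T = M /\ forall x : 'cV[R]_n, x != 0 -> 0 < (x^T *m M *m x) 0 0.

(* [rootsR p] lists the distinct roots of [p] in R in increasing order, so this
   is the nonincreasing list of the eigenvalues of [M] lying in R, each repeated
   according to its algebraic multiplicity; all the eigenvalues of a symmetric
   matrix lie in R, and the list then has length [n]. *)
Definition eigenvalues (R : rcfType) n (M : 'M[R]_n) : seq R :=
  flatten [seq nseq (mup a (char_poly M)) a | a <- rev (rootsR (char_poly M))].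

(* The index is 1-based: lambda 1 M >= ... >= lambda n M. *)
Definition lambda (R : rcfType) n (k : nat) (M : 'M[R]_n) : R :=
  (eigenvalues M)`_k.-1.

Definition cond_number (R : rcfType) n (M : 'M[R]_n) : R :=
  lambda 1 M / lambda n M.

Definition family_max (R : realDomainType) N (alpha : 'I_N.+1 -> R) : R :=
  \big[Num.max/alpha ord0]_i alpha i.

Definition family_min (R : realDomainType) N (alpha : 'I_N.+1 -> R) : R :=
  \big[Num.min/alpha ord0]_i alpha i.

(* Main.v *)
(* By Rayleigh quotients, lambda_1(Q + A) <= lambda_1(Q) + lambda_1(A) and
   lambda_n(Q + A) >= lambda_n(Q) + lambda_n(A), so k_(Q+A) is at most the
   mediant (lambda_1(Q) + lambda_1(A)) / (lambda_n(Q) + lambda_n(A)) of k_Q and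
   k_A, which is less than k_Q as soon as k_A < k_Q. *)
Require Import Defs.
From mathcomp Require Import all_boot all_order all_algebra.
From mathcomp Require Import polyrcf complex.

Set Implicit Arguments.
Unset Strict Implicit.
Unset Printing Implicit Defensive.

Import Order.TTheory GRing.Theory Num.Theory.
Local Open Scope ring_scope.

(** * Quadratic forms and the spectral theorem for real symmetric matrices *)

Definition qform {R : pzRingType} {n} (M : 'M[R]_n) (x : 'cV[R]_n) : R :=
  (x^T *m M *m x) 0 0.

Lemma qformD {R : pzRingType} {n} (M P : 'M[R]_n) (x : 'cV[R]_n) :
  qform (M + P) x = qform M x + qform P x.
Proof. by rewrite /qform mulmxDr mulmxDl mxE. Qed.

Lemma qform1_gt0 {R : realDomainType} {n} (x : 'cV[R]_n) :
  x != 0 -> 0 < qform 1%:M x.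
Proof.
move=> /cV0Pn[i xi]; rewrite /qform mulmx1 mxE (bigD1 i) //= !mxE -expr2.
rewrite ltr_pwDl // ?exprn_even_gt0 // sumr_ge0 // => j _.
by rewrite !mxE -expr2 sqr_ge0.
Qed.

Lemma char_poly_conj {F : fieldType} {n} (P M : 'M[F]_n) :
  P \in unitmx -> char_poly (invmx P *m M *m P) = char_poly M.
Proof.
move=> Pu; rewrite /char_poly /char_poly_mx.
set C := map_mx polyC.
have PC : C (invmx P) *m C P = 1%:M by rewrite /C -map_mxM mulVmx // map_mx1.
have -> : 'X%:M - C (invmx P *m M *m P) = C (invmx P) *m ('X%:M - C M) *m C P.
  by rewrite mulmxBr mulmxBl scalar_mxC -!mulmxA PC mulmx1 /C !map_mxM !mulmxA.
rewrite !det_mulmx mulrC mulrA -det_mulmx.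
by rewrite (mulmx1C PC) det1 mul1r.
Qed.

(* A real symmetric matrix is Hermitian over R[i], hence unitarily
   diagonalizable there with real eigenvalues; the weights [y] are the squared
   moduli of the coordinates of [x] in the unitary eigenbasis. *)
Lemma symmetric_spectral {R : rcfType} {n} (M : 'M[R]_n) : M^T = M ->
  exists2 r : 'I_n -> R, char_poly M = \prod_i ('X - (r i)%:P) &
    forall x : 'cV_n, exists y : 'I_n -> R,
      [/\ forall i, 0 <= y i, qform M x = \sum_i r i * y i
        & qform 1%:M x = \sum_i y i].
Proof.
move=> Msym; pose toC := real_complex R : {rmorphism R -> R[i]}.
have toC_conj a : (toC a)^* = toC a.
  by apply/CrealP/complex_realP; exists a.
set MC := map_mx toC M.
have MCreal : MC \is a mxOver Num.real.
  by apply/mxOverP => i j; rewrite mxE; apply/complex_realP; exists (M i j).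
have MCsym : MC \is symmetricmx.
  apply/is_hermitianmxP; rewrite expr0 scale1r map_mx_id //.
  by rewrite /MC map_trmx Msym.
have MCherm := realsym_hermsym MCsym MCreal.
have /orthomx_spectralP := hermitian_normalmx MCherm.
have /mxOverP Dreal := hermitian_spectral_diag_real MCherm.
have Pu := spectral_unitarymx MC.
move: Dreal Pu; set P := spectralmx MC; set D := spectral_diag MC.
move=> Dreal Pu MCE.
pose r i := complex.Re (D 0 i).
have rE i : toC (r i) = D 0 i by apply: RRe_real; apply: Dreal.
exists r.
  (* The factorization is checked over [R[i]], where [MC] is similar to [diag_mx D], and descends to
     [R] because [toC] is injective. *)
  apply: (map_poly_inj toC); rewrite map_char_poly -/MC MCE.
  rewrite char_poly_conj ?unitarymx_unit // char_poly_trig ?diag_mx_is_trig //.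
  rewrite rmorph_prod; apply: eq_bigr => i _.
  by rewrite rmorphB /= map_polyX map_polyC !mxE eqxx mulr1n -rE.
move=> x; pose xC := map_mx toC x; pose z := P *m xC.
pose y i := complex.Re (z i 0) ^+ 2 + complex.Im (z i 0) ^+ 2.
have yE i : toC (y i) = (z i 0)^* * z i 0.
  by rewrite /toC /= /y add_Re2_Im2 normCKC.
(* [xC] has real entries and the inverse of the unitary [P] is its conjugate transpose. *)
have zE : (map_mx Num.conj z)^T = xC^T *m invmx P.
  rewrite invmx_unitary // /z map_mxM trmx_mul; congr (_ *m _).
    by apply/matrixP => i j; rewrite !mxE; exact: toC_conj.
  by rewrite map_trmx.
(* The diagonal [E] stays arbitrary so that [E = D] gives the form of [M] and [E = const_mx 1] that
   of the identity, with the same weights [y]. *)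
have qE E : (xC^T *m (invmx P *m diag_mx E *m P) *m xC) 0 0
            = \sum_i E 0 i * toC (y i).
  rewrite !mulmxA -zE -mulmxA -/z mul_mx_diag mxE.
  by apply: eq_bigr => i _; rewrite yE mulrA [E 0 i * _]mulrC !mxE.
exists y; split.
- by move=> i; rewrite addr_ge0 ?sqr_ge0.
- apply: (fmorph_inj toC); rewrite rmorph_sum /=.
  have -> : toC (qform M x) = (xC^T *m MC *m xC) 0 0.
    by rewrite map_trmx -!map_mxM mxE.
  by rewrite MCE qE; apply: eq_bigr => i _; rewrite rmorphM /= rE.
- apply: (fmorph_inj toC); rewrite rmorph_sum /=.
  have -> : toC (qform 1%:M x) = (xC^T *m 1%:M *m xC) 0 0.
    by rewrite map_trmx -(map_mx1 toC) -!map_mxM mxE.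
  have -> : 1%:M = invmx P *m diag_mx (const_mx 1) *m P.
    by rewrite diag_const_mx mulmx1 mulVmx ?unitarymx_unit.
  by rewrite qE; apply: eq_bigr => i _; rewrite mxE mul1r.
Qed.

(** * The ordered list of eigenvalues *)

(** Both lists contain each [a] as often as its multiplicity as a root: [rootsR] has no duplicates,
    so [a] occurs only in its own block of [eigenvalues M]. *)
Lemma perm_eigenvalues {R : rcfType} {n} (M : 'M[R]_n) (s : seq R) :
  char_poly M = \prod_(a <- s) ('X - a%:P) -> perm_eq (eigenvalues M) s.
Proof.
move=> Ms; have M0 : char_poly M != 0 by rewrite monic_neq0 ?char_poly_monic.
apply/allP => a _ /=; apply/eqP.
rewrite -(mu_prod_XsubC a s) -Ms count_flatten -map_comp sumnE big_map.
under eq_bigr => b _ do rewrite /= count_nseq /=.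
have [ra|Nra] := boolP (root (char_poly M) a).
  have aR : a \in rev (rootsR (char_poly M)).
    by rewrite mem_rev -(roots_on_rootsR M0) in_itv.
  rewrite (big_rem a) //= eqxx mul1n big_seq big1 ?addn0 // => b.
  by rewrite mem_rem_uniq ?rev_uniq ?uniq_roots // inE => /andP[/negPf ->].
rewrite mupNroot // big_seq big1 // => b.
rewrite mem_rev -(roots_on_rootsR M0) in_itv /=.
by case: eqP => // ->; rewrite (negPf Nra).
Qed.

Lemma sorted_eigenvalues {R : rcfType} {n} (M : 'M[R]_n) :
  sorted >=%R (eigenvalues M).
Proof.
rewrite /eigenvalues; set f := fun a => _.
have: sorted >%R (rev (rootsR (char_poly M))).
  by rewrite rev_sorted sorted_roots.
have ge_trans : transitive (>=%R : rel R).
  by move=> ? ? ? /[swap]; exact: le_trans.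
have gt_trans : transitive (>%R : rel R).
  by move=> ? ? ? /[swap]; exact: lt_trans.
(* Unlike [sorted], [pairwise] splits over concatenation into a condition inside each block and one
   across blocks. *)
rewrite !sorted_pairwise //.
elim: (rev _) => //= a s IHs /andP[/allP a_s s_sorted].
rewrite pairwise_cat IHs // andbT; apply/andP; split.
  apply/allrelP => _ b /nseqP[-> _] /flatten_mapP[c cs /nseqP[-> _]].
  exact/ltW/a_s.
rewrite /f; elim: (mup a _) => //= m ->; rewrite andbT.
by apply/allP => b /nseqP[-> _] /=.
Qed.

(** Thanks to this, any splitting of the characteristic polynomial, in any order, can stand in for
    the sorted list. *)
Lemma lambda_extremal {R : rcfType} {n} (M : 'M[R]_n) (s : seq R) :
  (0 < n)%N -> char_poly M = \prod_(a <- s) ('X - a%:P) ->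
  [/\ lambda 1 M \in s, lambda n M \in s
    & forall a, a \in s -> lambda n M <= a <= lambda 1 M].
Proof.
move=> n0 Ms; have sM := perm_eigenvalues Ms.
(* The full length keeps the indices [0] and [n.-1] in range, so neither [lambda] falls back on the
   default value 0. *)
have szM : size (eigenvalues M) = n.
  by have := size_char_poly M; rewrite Ms size_prod_XsubC (perm_size sM) => -[].
have ge_trans : transitive (>=%R : rel R).
  by move=> ? ? ? /[swap]; exact: le_trans.
have mono i j : (i <= j < n)%N -> (eigenvalues M)`_j <= (eigenvalues M)`_i.
  move=> /andP[ij jn].
  apply: (sorted_leq_nth ge_trans (@lexx _ R) 0 (sorted_eigenvalues M));
    by rewrite ?inE ?szM // (leq_ltn_trans ij).
split; rewrite -?(perm_mem sM) ?mem_nth ?szM ?ltn_predL // => a.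
rewrite -(perm_mem sM) => /(nthP 0)[k]; rewrite szM => k_n <-.
rewrite /lambda (mono k n.-1) ?(mono 0%N k) //.
by rewrite -ltnS prednK // k_n leqnn.
Qed.

Lemma char_poly_symmetric {R : rcfType} {n} (M : 'M[R]_n) : M^T = M ->
  exists s : seq R, char_poly M = \prod_(a <- s) ('X - a%:P).
Proof.
case/symmetric_spectral => r Mr _; exists (map r (enum 'I_n)).
by rewrite big_map big_enum.
Qed.

(** * Rayleigh quotients and extreme eigenvalues of a sum *)

(** In spectral coordinates [qform M x] is a combination of eigenvalues with nonnegative weights
    whose total is [qform 1%:M x]. *)
Lemma lambda_rayleigh {R : rcfType} {n} (M : 'M[R]_n) (x : 'cV[R]_n) :
  (0 < n)%N -> M^T = M ->
  lambda n M * qform 1%:M x <= qform M x <= lambda 1 M * qform 1%:M x.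
Proof.
move=> n0 /symmetric_spectral[r Mr /(_ x)[y [y0 -> ->]]].
have Ms : char_poly M = \prod_(a <- map r (enum 'I_n)) ('X - a%:P).
  by rewrite big_map big_enum.
have [_ _ bnd] := lambda_extremal n0 Ms.
have {}bnd i : lambda n M <= r i <= lambda 1 M by rewrite bnd ?map_f ?mem_enum.
rewrite !mulr_sumr !ler_sum // => i _; rewrite ler_wpM2r //;
  by case/andP: (bnd i).
Qed.

Lemma symmetric_eigenvector {R : rcfType} {n} (M : 'M[R]_n) (a : R) :
  M^T = M -> root (char_poly M) a ->
  exists2 x : 'cV[R]_n, x != 0 & qform M x = a * qform 1%:M x.
Proof.
(* [eigenvalueP] yields a row eigenvector [v]; its transpose is the vector sought. *)
move=> Msym; rewrite -eigenvalue_root_char => /eigenvalueP[v vM v0].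
exists v^T; first by rewrite -trmx0 (inj_eq trmx_inj).
by rewrite /qform trmxK vM mulmx1 -scalemxAl mxE.
Qed.

(** Being roots of the characteristic polynomial, the extreme eigenvalues have eigenvectors, at
    which the Rayleigh bounds are attained. *)
Lemma lambda_eigenvector {R : rcfType} {n} (M : 'M[R]_n) :
  (0 < n)%N -> M^T = M ->
  (exists2 x : 'cV[R]_n, x != 0 & qform M x = lambda 1 M * qform 1%:M x) /\
  (exists2 x : 'cV[R]_n, x != 0 & qform M x = lambda n M * qform 1%:M x).
Proof.
move=> n0 Msym; have [s Ms] := char_poly_symmetric Msym.
have [s1 sn _] := lambda_extremal n0 Ms.
by split; apply: symmetric_eigenvector; rewrite // Ms root_prod_XsubC.
Qed.

Lemma lambda_le {R : rcfType} {n} (M : 'M[R]_n) :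
  (0 < n)%N -> M^T = M -> lambda n M <= lambda 1 M.
Proof.
move=> n0 /char_poly_symmetric[s Ms].
by have [s1 _ /(_ _ s1)/andP[]] := lambda_extremal n0 Ms.
Qed.

Lemma lambda_gt0 {R : rcfType} {n} (M : 'M[R]_n) :
  (0 < n)%N -> sym_posdef M -> 0 < lambda n M.
Proof.
move=> n0 [Msym Mpos]; have [_ [x x0 xM]] := lambda_eigenvector n0 Msym.
have := Mpos x x0; rewrite -/(qform M x) xM.
by rewrite pmulr_lgt0 ?qform1_gt0.
Qed.

Lemma lambda1_add_le {R : rcfType} {n} (M P : 'M[R]_n) :
  (0 < n)%N -> M^T = M -> P^T = P ->
  lambda 1 (M + P) <= lambda 1 M + lambda 1 P.
Proof.
move=> n0 Msym Psym; have MPsym : (M + P)^T = M + P.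
  by rewrite linearD /= Msym Psym.
(* At a top eigenvector of [M + P] the two forms add up, and each obeys its own Rayleigh bound. *)
have [[x x0 xMP] _] := lambda_eigenvector n0 MPsym.
rewrite -(ler_pM2r (qform1_gt0 x0)) -xMP qformD mulrDl.
have /andP[_ leM] := lambda_rayleigh x n0 Msym.
have /andP[_ leP] := lambda_rayleigh x n0 Psym.
exact: lerD.
Qed.

Lemma lambdan_add_ge {R : rcfType} {n} (M P : 'M[R]_n) :
  (0 < n)%N -> M^T = M -> P^T = P ->
  lambda n M + lambda n P <= lambda n (M + P).
Proof.
move=> n0 Msym Psym; have MPsym : (M + P)^T = M + P.
  by rewrite linearD /= Msym Psym.
have [_ [x x0 xMP]] := lambda_eigenvector n0 MPsym.
rewrite -(ler_pM2r (qform1_gt0 x0)) -xMP qformD mulrDl.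
have /andP[leM _] := lambda_rayleigh x n0 Msym.
have /andP[leP _] := lambda_rayleigh x n0 Psym.
exact: lerD.
Qed.

(** * Spectrum of a block-scalar matrix *)

Lemma mxdiag_scalar_diag {R : pzRingType} {N} (n_ : 'I_N -> nat)
    (alpha : 'I_N -> R) :
  \mxdiag_(i < N) ((alpha i)%:M : 'M[R]_(n_ i)) =
  diag_mx (\row_k alpha (tagnat.sig1 k)).
Proof.
transitivity (diag_mx (\mxrow_(i < N) (const_mx (alpha i) : 'rV[R]_(n_ i)))).
  by rewrite diag_mxrow; apply: eq_mxdiag => i; rewrite diag_const_mx.
by congr diag_mx; apply/rowP => k; rewrite !mxE.
Qed.

Lemma lambda_mxdiag_scalar {R : rcfType} {N} (n_ : 'I_N.+1 -> nat)
    (alpha : 'I_N.+1 -> R)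
    (A := \mxdiag_(i < N.+1) ((alpha i)%:M : 'M[R]_(n_ i))) :
  (forall i, (0 < n_ i)%N) ->
  lambda 1 A = family_max alpha /\ lambda (\sum_i n_ i) A = family_min alpha.
Proof.
move=> n_gt0.
(* The first index of block [i]. It exists because the block is nonempty, and it makes every
   [alpha i] an eigenvalue of [A]. *)
pose rank0 i : 'I_(\sum_i n_ i) := tagnat.Rank i (Ordinal (n_gt0 i)).
have n0 : (0 < \sum_i n_ i)%N by apply: leq_ltn_trans (ltn_ord (rank0 ord0)).
pose s := [seq alpha (tagnat.sig1 k) | k <- enum 'I_(\sum_i n_ i)].
have As : char_poly A = \prod_(a <- s) ('X - a%:P).
  rewrite /A mxdiag_scalar_diag char_poly_trig ?diag_mx_is_trig //.
  rewrite big_map big_enum; apply: eq_bigr => i _.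
  by rewrite !mxE eqxx mulr1n.
have alpha_s i : alpha i \in s.
  by apply/mapP; exists (rank0 i); rewrite ?mem_enum ?tagnat.Rank1K.
have [/mapP[k1 _ l1] /mapP[kn _ ln] bnd] := lambda_extremal n0 As.
have alpha_le i : alpha i <= lambda 1 A by case/andP: (bnd _ (alpha_s i)).
have alpha_ge i : lambda (\sum_i n_ i) A <= alpha i.
  by case/andP: (bnd _ (alpha_s i)).
(* Each extreme eigenvalue is some [alpha] value and also bounds all of them. *)
split; apply/le_anti/andP; split.
- by rewrite l1 le_bigmax.
- by apply/bigmax_leP; split=> [|i _]; apply: alpha_le.
- by apply/bigmin_geP; split=> [|i _]; apply: alpha_ge.
- by rewrite ln bigmin_le.
Qed.

Theorem theorem5 (R : rcfType) (N : nat) (n_ : 'I_N.+1 -> nat)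
    (n_gt0 : forall i, (0 < n_ i)%N)
    (Q : 'M[R]_(\sum_i n_ i)) (Q_spd : sym_posdef Q)
    (alpha : 'I_N.+1 -> R) (A : 'M[R]_(\sum_i n_ i))
    (A_diag : A = \mxdiag_(i < N.+1) ((alpha i)%:M : 'M[R]_(n_ i)))
    (A_spd : sym_posdef A) :
  cond_number A = family_max alpha / family_min alpha /\
  (family_max alpha / family_min alpha < cond_number Q ->
   cond_number (Q + A) < cond_number Q).
Proof.
have [A1 An] := lambda_mxdiag_scalar alpha n_gt0; rewrite -A_diag in A1 An.
rewrite -A1 -An; split=> //; rewrite /cond_number => kAQ.
have n0 : (0 < \sum_i n_ i)%N.
  by rewrite big_ord_recl ltn_addr.
have Q0 := lambda_gt0 n0 Q_spd; have A0 := lambda_gt0 n0 A_spd.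
have [[Qsym _] [Asym _]] := (Q_spd, A_spd).
have le1 := lambda1_add_le n0 Qsym Asym.
have len := lambdan_add_ge n0 Qsym Asym.
have QA0 := lt_le_trans (addr_gt0 Q0 A0) len.
rewrite ltr_pdivrMr //; apply: le_lt_trans le1 _.
set k := lambda 1 Q / _ in kAQ *.
have k0 : 0 <= k by rewrite divr_ge0 ?(le_trans (ltW Q0)) ?lambda_le // ltW.
apply: lt_le_trans (ler_wpM2l k0 len).
(* As [k * lambda n Q = lambda 1 Q], with [n] the total size, cancelling [lambda 1 Q] leaves
   [lambda 1 A < k * lambda n A], which is [kAQ] with the denominator cleared. *)
by rewrite mulrDr divfK ?gt_eqF // ltrD2l -ltr_pdivrMr.
Qed.
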